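(* Let $n,k$ be positive integers with $n\ge 2k$ and $\gcd(n,k)=1$, and let $a$ and $b$ be the smallest positive integers satisfying $ak=bn-1$. Then: (1) $\chi_f(Q(n,k))=\frac{n}{k}=\chi_f(\mathrm{SG}(n,k))$; (2) for every vertex $U\in V(Q(n,k))$ we have $\chi_f(Q(n,k)\setminus\{U\})=\frac{a}{b}<\frac{n}{k}$; that is, $Q(n,k)$ is vertex-critical for the fractional chromatic number; (3) $Q(n,k)$ contains an induced subgraph isomorphic to $Q(a,b)$.
   Context: For a positive integer $n$ let $[n]=\{1,\dots,n\}$ and let $C_n$ be the cycle on $[n]$ with edges $\{i,i+1\}$ ($1\le i\le n-1$) and $\{n,1\}$. For $n\ge 2k$, the Kneser graph $\mathrm{KG}(n,k)$ has as vertices the $k$-element subsets of $[n]$, two being adjacent iff they are disjoint. The Schrijver graph $\mathrm{SG}(n,k)$ is the induced subgraph of $\mathrm{KG}(n,k)$ on the $k$-subsets containing no two cyclically consecutive elements (i.e. the $k$-element independent sets of $C_n$). An arc of $C_n$ is a set of the form $\{i,i+1,\dots,i+m-1\}$ (addition modulo $n$) with $1\le m\le n-1$, i.e. a vertex set inducing a path in $C_n$. A set $U\subseteq[n]$ is well-spread if for any two arcs $A,B$ with $|A|=|B|$ we have $\big||A\cap U|-|B\cap U|\big|\le 1$. $Q(n,k)$ denotes the induced subgraph of $\mathrm{SG}(n,k)$ on all well-spread $k$-subsets of $[n]$. $\chi_f(G)$ is the fractional chromatic number: the minimum total nonnegative weight on independent sets of $G$ such that every vertex is covered by total weight at least $1$.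 $G\setminus\{U\}$ denotes $G$ with vertex $U$ deleted. *)

(* Defs.v *)
From HB Require Import structures.
From mathcomp Require Import all_boot all_order all_algebra.
Set Implicit Arguments.
Unset Strict Implicit.
Unset Printing Implicit Defensive.
Import Order.TTheory GRing.Theory Num.Theory.

Record sgraph := SGraph {
  vert :> finType;
  adj : rel vert;
  adj_sym : symmetric adj;
  adj_irrefl : irreflexive adj }.

Section Graphs.
Implicit Types G H : sgraph.

Definition indep G (I : {set G}) : bool :=
  [forall x in I, forall y in I, ~~ adj x y].

Definition induced_adj G (S : {set G}) : rel {x : G | x \in S} :=
  fun x y => adj (val x) (val y).

Lemma induced_adj_sym G (S : {set G}) : symmetric (@induced_adj G S).
Proof. by move=> x y; exact: adj_sym. Qed.

Lemma induced_adj_irrefl G (S : {set G}) : irreflexive (@induced_adj G S).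
Proof. by move=> x; exact: adj_irrefl. Qed.

Definition induced G (S : {set G}) : sgraph :=
  SGraph (@induced_adj_sym G S) (@induced_adj_irrefl G S).

Definition delete_vertex G (v : G) : sgraph := induced [set~ v].

Definition isomorphic G H : Prop :=
  exists2 f : G -> H, bijective f & {mono f : x y / adj x y}.

Definition has_induced_copy G H : Prop :=
  exists S : {set G}, isomorphic (induced S) H.

End Graphs.

Section FractionalChromaticNumber.
Local Open Scope ring_scope.
Variable R : realFieldType.
Implicit Types G : sgraph.

(* Only the values of [w] on independent sets matter. *)
Definition fractional_coloring G (w : {set G} -> R) : Prop :=
  (forall I, indep I -> 0 <= w I) /\
  (forall v : G, 1 <= \sum_(I : {set G} | indep I && (v \in I)) w I).

Definition total_weight G (w : {set G} -> R) : R :=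
  \sum_(I : {set G} | indep I) w I.

(* [chi_f_is G c] says that the minimum defining the fractional chromatic
   number of G exists and equals c. *)
Definition chi_f_is G (c : R) : Prop :=
  (exists2 w : {set G} -> R, fractional_coloring w & total_weight w = c) /\
  (forall w : {set G} -> R, fractional_coloring w -> c <= total_weight w).

Definition chi_f_vertex_critical G : Prop :=
  exists2 c : R, chi_f_is G c &
    forall v : G, exists2 c' : R, chi_f_is (delete_vertex v) c' & c' < c.

End FractionalChromaticNumber.

(* The ground set {1, ..., n} is represented by 'I_n = {0, ..., n - 1}. *)

(* The test [i != j] only matters for n = 1: C_1 has no loop. *)
Definition cycle_adj (n : nat) : rel 'I_n := fun i j =>
  (i != j) && ((i.+1 %% n == j) || (j.+1 %% n == i)).

Lemma cycle_adj_sym n : symmetric (@cycle_adj n).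
Proof. by move=> i j; rewrite /cycle_adj eq_sym orbC. Qed.

Lemma cycle_adj_irrefl n : irreflexive (@cycle_adj n).
Proof. by move=> i; rewrite /cycle_adj eqxx. Qed.

Definition cycle_graph (n : nat) : sgraph :=
  SGraph (@cycle_adj_sym n) (@cycle_adj_irrefl n).

(* The test [A != B] only matters for k = 0. *)
Definition kneser_adj (n k : nat) : rel {A : {set 'I_n} | #|A| == k} :=
  fun A B => (A != B) && [disjoint val A & val B].

Lemma kneser_adj_sym n k : symmetric (@kneser_adj n k).
Proof. by move=> A B; rewrite /kneser_adj eq_sym disjoint_sym. Qed.

Lemma kneser_adj_irrefl n k : irreflexive (@kneser_adj n k).
Proof. by move=> A; rewrite /kneser_adj eqxx. Qed.

Definition KG (n k : nat) : sgraph :=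
  SGraph (@kneser_adj_sym n k) (@kneser_adj_irrefl n k).

Definition SG (n k : nat) : sgraph :=
  induced [set A : KG n k | @indep (cycle_graph n) (val A)].

(* The length m ranges over 'I_n with 0 < m, that is 1 <= m <= n - 1. *)
Definition is_arc (n : nat) (A : {set 'I_n}) : bool :=
  [exists i : 'I_n, exists m : 'I_n,
    (0 < m) && (A == [set j : 'I_n | [exists t : 'I_m, (i + t) %% n == j]])].

Definition well_spread (n : nat) (U : {set 'I_n}) : bool :=
  [forall A : {set 'I_n}, forall B : {set 'I_n},
    [&& is_arc A, is_arc B & #|A| == #|B|] ==>
      (`| #|A :&: U| - #|B :&: U| | <= 1)%N].

Definition Q (n k : nat) : sgraph :=
  induced [set A : SG n k | well_spread (val (val A))].

(* Main.v *)
(* For coprime [n] and [k] the well-spread [k]-sets are the [n] rotations of one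
   Christoffel word, so [Q n k] is the circular complete graph [circ n k]: its
   vertices are the residues modulo [n], adjacent at cyclic distance at least
   [k].  Its independent sets have at most [k] elements, which bounds the
   fractional chromatic number from below by [n / k], and the stars
   [{A | i \in A}] colour all of [SG n k] with total weight [n / k].  Since
   [b * n - a * k = 1], multiplication by [n / a] and rounding embeds [circ a b]
   as an induced subgraph of [circ n k] missing a vertex, and multiplication by
   [a / n] maps [circ n k] minus that vertex back to [circ a b], so deleting a
   vertex leaves the value [a / b]. *)
Require Import Defs.
From HB Require Import structures.
From mathcomp Require Import all_boot all_order all_algebra.
From mathcomp Require Import zify.
Set Implicit Arguments.
Unset Strict Implicit.
Unset Printing Implicit Defensive.
Import Order.TTheory GRing.Theory Num.Theory.

(** * Graph homomorphisms and bounds on fractional colourings *)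

Definition graph_hom (G H : sgraph) (f : G -> H) : Prop :=
  forall x y, adj x y -> adj (f x) (f y).

Section FractionalColorings.
Local Open Scope ring_scope.
Variable R : realFieldType.
Implicit Types G H : sgraph.

Lemma indepP G (I : {set G}) :
  reflect {in I &, forall x y, ~~ adj x y} (indep I).
Proof.
apply: (iffP 'forall_in_forall_inP) => h x y; first by move=> xI yI; exact: h.
by move=> xI yI; apply: h.
Qed.

Lemma indep_preimset G H (f : G -> H) (J : {set H}) :
  graph_hom f -> indep J -> indep (f @^-1: J).
Proof.
move=> hf /indepP iJ; apply/indepP => x y; rewrite !inE => xJ yJ.
by apply: contra (iJ _ _ xJ yJ); exact: hf.
Qed.

(** The weight of each independent set of [H] moves to its preimage; several sets may share a
    preimage, so weights are added over each fibre. *)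
Lemma fractional_coloring_pullback G H (f : G -> H) (w : {set H} -> R) :
  graph_hom f -> fractional_coloring w ->
  exists2 w' : {set G} -> R,
    fractional_coloring w' & total_weight w' = total_weight w.
Proof.
move=> hf [w0 w1].
exists (fun I => \sum_(J : {set H} | indep J && (f @^-1: J == I)) w J).
  split=> [I _|v]; first by apply: sumr_ge0 => J /andP[/w0].
  apply: le_trans (w1 (f v)) _.
  rewrite (partition_big (fun J : {set H} => f @^-1: J)
             (fun I : {set G} => indep I && (v \in I))) /=; last first.
    by move=> J /andP[iJ vJ]; rewrite (indep_preimset hf iJ) inE.
  apply: ler_sum => I /andP[_ vI]; rewrite le_eqVlt; apply/orP; left; apply/eqP.
  apply: eq_bigl => J; case: eqP => [E|]; rewrite ?andbF //.
  by move: vI; rewrite -E inE => ->; rewrite !andbT.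
rewrite /total_weight [RHS](partition_big (fun J : {set H} => f @^-1: J)
             (fun I : {set G} => indep I)) //=.
by move=> J iJ; exact: indep_preimset.
Qed.

(** A set occurring [m] times in the family [F] gets weight [m / k]. *)
Lemma uniform_fractional_coloring G (T : finType) (F : T -> {set G}) (k : nat) :
  (0 < k)%N -> (forall t, indep (F t)) ->
  (forall v, k <= #|[set t | v \in F t]|)%N ->
  exists2 w : {set G} -> R,
    fractional_coloring w & total_weight w = #|T|%:R / k%:R.
Proof.
move=> k_gt0 iF cF; have k0 : 0 < k%:R :> R by rewrite ltr0n.
have sumF (P : pred {set G}) :
    \sum_(I | P I) (#|[set t | F t == I]|%:R / k%:R : R) =
    #|[set t | P (F t)]|%:R / k%:R.
  rewrite -mulr_suml -natr_sum; congr (_%:R / _).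
  under eq_bigr do rewrite -sum1dep_card.
  rewrite -sum1dep_card [RHS](partition_big F P) //=.
  apply: eq_bigr => I PI; apply: eq_bigl => t.
  by case: eqP => [->|]; rewrite ?PI ?andbF.
exists (fun I => #|[set t | F t == I]|%:R / k%:R).
  split=> [I _|v]; first by rewrite divr_ge0 ?ler0n.
  rewrite (sumF (fun I => indep I && (v \in I))) ler_pdivlMr // mul1r ler_nat.
  apply: leq_trans (cF v) _; apply: subset_leq_card.
  by apply/subsetP => t; rewrite !inE iF.
rewrite /total_weight sumF; congr (_%:R / _).
by rewrite -cardsT; apply: eq_card => t; rewrite !inE iF.
Qed.

(** Double counting: the coverings of all vertices sum to at least [#|G|], while each independent
    set contributes its weight at most [k] times. *)
Lemma total_weight_ge_card_ratio G (k : nat) (w : {set G} -> R) :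
  (0 < k)%N -> (forall I : {set G}, indep I -> (#|I| <= k)%N) ->
  fractional_coloring w -> #|G|%:R / k%:R <= total_weight w.
Proof.
move=> k_gt0 ak [w0 w1]; rewrite ler_pdivrMr ?ltr0n //.
have -> : #|G|%:R = \sum_(v : G) (1 : R) by rewrite sumr_const.
apply: le_trans (ler_sum _ (fun v _ => w1 v)) _.
rewrite (exchange_big_dep (fun I : {set G} => indep I)) /=; last first.
  by move=> v I _ /andP[].
rewrite /total_weight mulr_suml; apply: ler_sum => I iI.
rewrite (eq_bigl (fun v => v \in I)) => [|v]; last by rewrite iI.
rewrite sumr_const -[_ *+ #|I|]mulr_natr.
by apply: ler_wpM2l; rewrite ?w0 // ler_nat ak.
Qed.

End FractionalColorings.

Lemma has_induced_copy_mono (G H : sgraph) (f : H -> G) :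
  injective f -> {mono f : x y / adj x y} -> has_induced_copy G H.
Proof.
move=> injf mf; exists [set y in codom f].
have mem_im (y : induced [set y in codom f]) : val y \in codom f.
  by move: (valP y); rewrite inE.
exists (fun y => iinv (mem_im y)); last first.
  by move=> x y; rewrite -mf !f_iinv.
have im_mem x : f x \in [set y in codom f] by rewrite inE codom_f.
exists (fun x => exist _ (f x) (im_mem x) : induced _) => [y|x].
  by apply: val_inj; rewrite /= f_iinv.
by apply: injf; rewrite f_iinv.
Qed.

(** * Circular complete graphs and their independent sets *)

Definition circ_adj (n k : nat) : rel 'I_n :=
  fun x y => (x != y) && (k <= maxn x y - minn x y <= n - k).

Lemma circ_adj_sym n k : symmetric (@circ_adj n k).
Proof. by move=> x y; rewrite /circ_adj eq_sym maxnC minnC. Qed.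

Lemma circ_adj_irrefl n k : irreflexive (@circ_adj n k).
Proof. by move=> x; rewrite /circ_adj eqxx. Qed.

Definition circ (n k : nat) : sgraph :=
  SGraph (@circ_adj_sym n k) (@circ_adj_irrefl n k).

Lemma circ_adjE n k (x y : circ n k) : 0 < k ->
  adj x y = (k <= maxn x y - minn x y <= n - k).
Proof.
move=> k_gt0; rewrite /= /circ_adj; case: eqP => //= ->; lia.
Qed.

(* Relative to a member [x], the members of an independent set lie at clockwise
   distance [< k] or [> n - k]; distances [d] and [d + (n - k)] exclude each
   other, so the distances are distinct modulo [n - k]. *)
Lemma circ_indep_card n k (I : {set circ n k}) :
  0 < k -> 2 * k <= n \/ n = 1 -> indep I -> #|I| <= k.
Proof.
move=> k_gt0 [le_2k_n|n1] /indepP iI; last first.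
  by apply: leq_trans (max_card _) _; rewrite card_ord n1.
case: (set_0Vmem I) => [->|[x xI]]; first by rewrite cards0.
pose d (y : 'I_n) : nat := if x <= y then y - x else y + n - x.
pose h (y : 'I_n) := inord (if d y < k then d y else d y + k - n) : 'I_k.-1.+1.
suff inj_h : {in I &, injective h}.
  rewrite -(card_in_imset inj_h); apply: leq_trans (max_card _) _.
  by rewrite card_ord prednK.
move=> y z yI zI.
(* The four cases record whether the clockwise walk from [x] passes [0] and whether [n - k] was
   subtracted, written without subtraction. *)
have dP (y' : 'I_n) : y' \in I ->
    h y' + x = y' \/ h y' + x = y' + n \/
    h y' + x + n = y' + k \/ h y' + x = y' + k.
  move=> y'I; have := iI _ _ y'I xI; rewrite circ_adjE // => nadj.
  have xn := ltn_ord x; have yn := ltn_ord y'.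
  have d_lt : d y' < n by rewrite /d; case: (leqP x); lia.
  have d_far : d y' < k \/ n - k < d y' by rewrite /d; case: (leqP x); lia.
  have dE : d y' + x = y' \/ d y' + x = y' + n.
    by rewrite /d; case: (leqP x); lia.
  by rewrite /h; case: (ltnP (d _) k) => dk; rewrite inordK; lia.
have far : [/\ y + k <> z, z + k <> y, y + n <> z + k & z + n <> y + k].
  by have := iI _ _ yI zI; rewrite circ_adjE //; split; lia.
move=> E; apply: val_inj => /=; case: far.
have xn := ltn_ord x; have yn := ltn_ord y; have zn := ltn_ord z.
by case: (dP _ yI) => [|[|[|]]]; case: (dP _ zI) => [|[|[|]]]; rewrite E; lia.
Qed.

Lemma circ_total_weight (R : realFieldType) n k (w : {set circ n k} -> R) :
  0 < k -> 2 * k <= n \/ n = 1 ->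
  fractional_coloring w -> (n%:R / k%:R <= total_weight w)%R.
Proof.
move=> k0 h fw.
have := total_weight_ge_card_ratio k0 (fun I => @circ_indep_card n k I k0 h) fw.
by rewrite card_ord.
Qed.

(** * Counting the members of a set along arcs *)

Section CyclicCounts.
Variables (n : nat) (n_gt0 : 0 < n).

Definition ordmod (x : nat) : 'I_n := Ordinal (ltn_pmod x n_gt0).

Lemma ordmod_eq x y : x = y %[mod n] -> ordmod x = ordmod y.
Proof. by move=> e; apply: val_inj. Qed.

Lemma ordmod_id (i : 'I_n) : ordmod i = i.
Proof. by apply: val_inj; rewrite /= modn_small. Qed.

(** Start and length are natural numbers, reduced modulo [n] only at membership, so that counts add
    under concatenation of arcs, also past a full turn. *)
Definition arc_count (U : {set 'I_n}) (i m : nat) : nat :=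
  \sum_(t < m) (ordmod (i + t) \in U).

(** This is convertible with the set inside [is_arc], but allows any length, in particular [n]. *)
Definition arc (i : 'I_n) (m : nat) : {set 'I_n} :=
  [set j : 'I_n | [exists t : 'I_m, (i + t) %% n == j]].

Lemma arcI_card (U : {set 'I_n}) (i : 'I_n) m :
  m <= n -> #|arc i m :&: U| = arc_count U i m.
Proof.
move=> le_mn.
have arcE : arc i m = [set ordmod (i + t) | t : 'I_m].
  apply/setP=> j; rewrite inE; apply/existsP/imsetP => [[t /eqP e]|[t _ ->]].
    by exists t => //; apply: val_inj.
  by exists t.
have inj : injective (fun t : 'I_m => ordmod (i + t)).
  move=> s t /(congr1 val) /= /eqP; rewrite eqn_modDl.
  rewrite !modn_small ?(leq_trans (ltn_ord _) le_mn) // => /eqP; exact: val_inj.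
rewrite -sum1_card (eq_bigl (fun j => (j \in arc i m) && (j \in U)));
  last by move=> j; rewrite inE.
rewrite big_mkcondr /= arcE big_imset /=; last by move=> x y _ _; apply: inj.
by apply: eq_bigr => t _; case: (_ \in U).
Qed.

Lemma arc_card (i : 'I_n) m : m <= n -> #|arc i m| = m.
Proof.
move=> le_mn; rewrite -[arc i m]setIT arcI_card // /arc_count.
by under eq_bigr do rewrite inE; rewrite sum1_card card_ord.
Qed.

(** Arcs of equal size have equal length, and exchanging [i] and [j] turns the one-sided bound into
    the absolute one. *)
Lemma well_spreadP (U : {set 'I_n}) :
  reflect (forall (i j : 'I_n) m, 0 < m < n ->
             arc_count U i m <= (arc_count U j m).+1)
          (well_spread U).
Proof.
apply: (iffP forallP) => [ws i j m /andP[m0 mn]|h A].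
  have /forallP/(_ (arc j m)) := ws (arc i m).
  have isarc l : is_arc (arc l m).
    apply/existsP; exists l; apply/existsP; exists (Ordinal mn).
    by rewrite /= m0 eqxx.
  rewrite !isarc !arc_card ?(ltnW mn) // eqxx /= !arcI_card ?(ltnW mn) //; lia.
apply/forallP => B; apply/implyP => /and3P[].
move=> /existsP[i /existsP[m /andP[m0 /eqP eA]]].
move=> /existsP[j /existsP[p /andP[p0 /eqP eB]]].
have {}eA : A = arc i m by [].
have {}eB : B = arc j p by [].
rewrite eA eB !arc_card ?(ltnW (ltn_ord _)) // => /eqP e; rewrite -e.
rewrite !arcI_card ?(ltnW (ltn_ord _)) //.
have m01 : 0 < m < n by rewrite m0 ltn_ord.
have := h i j _ m01; have := h j i _ m01; lia.
Qed.

Lemma arc_countD U i m p :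
  arc_count U i (m + p) = arc_count U i m + arc_count U (i + m) p.
Proof.
rewrite /arc_count big_split_ord /=; congr (_ + _).
by apply: eq_bigr => t _; rewrite addnA.
Qed.

Lemma arc_count_mod U i m : arc_count U (i %% n) m = arc_count U i m.
Proof.
apply: eq_bigr => t _; congr (nat_of_bool (_ \in U)).
by apply: ordmod_eq; rewrite modnDml.
Qed.

Lemma arc_count1 U i : arc_count U i 1 = (ordmod i \in U).
Proof. by rewrite /arc_count big_ord1 addn0. Qed.

Lemma arc_count0 U i : arc_count U i 0 = 0.
Proof. by rewrite /arc_count big_ord0. Qed.

Lemma arc_count_full U i : arc_count U i n = #|U|.
Proof.
rewrite -arc_count_mod -(arcI_card U (ordmod i)) //.
rewrite (_ : arc _ n = setT) ?setTI //.
by apply/eqP; rewrite eqEcard subsetT cardsT card_ord arc_card /=.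
Qed.

Lemma sum_arc_count U m : \sum_(i < n) arc_count U i m = m * #|U|.
Proof.
rewrite exchange_big /= -[m in RHS]card_ord -sum_nat_const.
apply: eq_bigr => t _; rewrite -(arc_count_full U t).
by apply: eq_bigr => i _; rewrite addnC.
Qed.

(* The average of the counts over all positions is [m * #|U| / n]. *)
Lemma well_spread_arc_count U i m : well_spread U -> m < n ->
  m * #|U| < n * arc_count U i m + n /\ n * arc_count U i m < m * #|U| + n.
Proof.
move=> /well_spreadP ws mn; rewrite -arc_count_mod.
have [->|m0] := posnP m; first by rewrite arc_count0; lia.
have m01 : 0 < m < n by rewrite m0.
pose i0 := ordmod i; set v := arc_count U _ _.
rewrite -(sum_arc_count U m) (bigD1 i0) //= -/v.
have cardn : \sum_(j < n | j != i0) 1 = n.-1.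
  by rewrite sum1_card cardC1 card_ord.
(* Each of the other [n - 1] counts differs from [v] by at most one, so the whole sum is less than
   [n] away from [n * v]. *)
have le1 : \sum_(j < n | j != i0) arc_count U j m <= n.-1 * v.+1.
  rewrite -cardn big_distrl /=; apply: leq_sum => j _; rewrite mul1n.
  exact: (ws j i0).
have le2 : n.-1 * v <= \sum_(j < n | j != i0) arc_count U j m + n.-1.
  rewrite -[X in _ <= _ + X]cardn -big_split -cardn big_distrl /=.
  by apply: leq_sum => j _; rewrite mul1n addn1; apply: (ws i0 j).
move: (\sum_(j < n | _) _) v le1 le2 => T v; have := prednK n_gt0; nia.
Qed.

End CyclicCounts.

(** * Well-spread sets as rotations of a Christoffel word *)

Section RotationSets.
Variables (n k : nat).
Hypothesis n_gt0 : 0 < n.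

(* The Christoffel word of slope [k / n] with intercept [c]: [i] belongs to the
   set iff the sequence [(k * i + c) %/ n] jumps between [i] and [i.+1]. *)
Definition rotset (c : nat) : {set 'I_n} :=
  [set i : 'I_n | n - k <= (k * i + c) %% n].

Lemma mem_rotset_ordmod c x :
  (ordmod n_gt0 x \in rotset c) = (n - k <= (k * x + c) %% n).
Proof. by rewrite inE /= -modnDml modnMmr modnDml. Qed.

Hypothesis le_kn : k <= n.

(** As [k <= n], adding [k] carries at most once, namely when the residue is among the last [k]. *)
Lemma divn_rotset x :
  (x + k) %/ n = x %/ n + (n - k <= x %% n).
Proof.
rewrite {1}(divn_eq x n) -addnA divnMDl //; congr (_ + _).
have := ltn_pmod x n_gt0; case: (leqP (n - k)) => h1 h2;
  last by rewrite divn_small //; lia.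
rewrite -[x %% n + k](subnK (m := n)); last lia.
by rewrite divnDr ?dvdnn // divnn n_gt0 divn_small //; lia.
Qed.

Lemma rotset_arc_count c i m :
  (k * i + c) %/ n + arc_count n_gt0 (rotset c) i m = (k * (i + m) + c) %/ n.
Proof.
elim: m => [|m IH]; first by rewrite arc_count0 !addn0.
rewrite -[m.+1]addn1 arc_countD arc_count1 addnA IH mem_rotset_ordmod.
by rewrite -divn_rotset; congr (_ %/ _); lia.
Qed.

Lemma rotset_card c : #|rotset c| = k.
Proof.
apply/eqP; rewrite -(arc_count_full n_gt0 _ 0) -(eqn_add2l ((k * 0 + c) %/ n)).
by rewrite rotset_arc_count add0n muln0 add0n divnMDl // addnC.
Qed.

Lemma rotset_well_spread c : well_spread (rotset c).
Proof.
apply/(well_spreadP n_gt0) => i j m _.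
have ei := rotset_arc_count c i m; have ej := rotset_arc_count c j m.
move: (arc_count _ _ i m) (arc_count _ _ j m) ei ej => B A ei ej.
have := divn_eq (k * i + c) n; have := divn_eq (k * (i + m) + c) n.
have := divn_eq (k * j + c) n; have := divn_eq (k * (j + m) + c) n.
have := ltn_pmod (k * i + c) n_gt0; have := ltn_pmod (k * (i + m) + c) n_gt0.
have := ltn_pmod (k * j + c) n_gt0; have := ltn_pmod (k * (j + m) + c) n_gt0.
rewrite -ei -ej => h1 h2 h3 h4 e1 e2 e3 e4.
(* Both counts are less than one away from [k * m / n], so they differ by less than two. *)
have : n * B < n * A.+2 by nia.
by rewrite ltn_pmul2l // ltnS.
Qed.

(* Starting from a minimum of [n * arc_count 0 i - k * i], every count is the
   upper rounding of its average. *)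
Lemma well_spread_rotset U : well_spread U -> #|U| = k ->
  exists c : 'I_n, U = rotset c.
Proof.
move=> ws cU; pose S i := arc_count n_gt0 U 0 i.
(* The summand [k * (n - i)] stands for [- k * i], shifted by [k * n] to stay a natural number. *)
have [i0 _ min0] := @arg_minnP 'I_n (ordmod n_gt0 0) predT
                      (fun i => n * S i + k * (n - i)) isT.
have cnt m : m <= n -> arc_count n_gt0 U i0 m = (k * m + n - 1) %/ n.
  move=> mn; suff [ge hi] : k * m <= n * arc_count n_gt0 U i0 m /\
                          n * arc_count n_gt0 U i0 m < k * m + n.
    move: (arc_count _ _ _ _) ge hi => q ge hi.
    have -> : k * m + n - 1 = q * n + (k * m + n - 1 - q * n) by nia.
    by rewrite divnMDl // divn_small ?addn0 //; nia.
  move: mn; rewrite leq_eqVlt => /predU1P[->|mn].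
    rewrite arc_count_full cU; nia.
  have [_ hi] := well_spread_arc_count n_gt0 i0 ws mn.
  rewrite cU [m * k]mulnC in hi; split=> //.
  have Sm : S (i0 + m) = S i0 + arc_count n_gt0 U i0 m by rewrite /S arc_countD.
  have i0n := ltn_ord i0; case: (ltnP (i0 + m) n) => h.
    have /= := min0 (Ordinal h) isT; rewrite Sm; nia.
  (* Past the end, minimality is applied one turn earlier, where [S] is smaller by [k]. *)
  have h' : i0 + m - n < n by lia.
  have /= := min0 (Ordinal h') isT.
  have : S (i0 + m) = S (i0 + m - n) + k.
    rewrite -{1}(subnKC h) /S arc_countD arc_count_full cU addnC; congr (_ + _).
    by rewrite -[LHS]arc_count_mod add0n modnn.
  rewrite Sm; nia.
(* Modulo [n] this intercept is [n - 1 - k * i0], so that the index [i0 + m] gets the residue of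
   [k * m + n - 1]. *)
exists (ordmod n_gt0 (n - 1 + k * (n - i0))); apply/setP => j.
pose m := (j + (n - i0)) %% n; have mn : m < n by rewrite ltn_pmod.
have i0n := ltn_ord i0.
have -> : j = ordmod n_gt0 (i0 + m).
  rewrite -[LHS](ordmod_id n_gt0); apply: ordmod_eq.
  by rewrite modnDmr addnCA subnKC ?(ltnW i0n) // modnDr.
rewrite mem_rotset_ordmod /= modnDmr.
have -> : k * (i0 + m) + (n - 1 + k * (n - i0)) = k * n + (k * m + n - 1).
  by nia.
rewrite modnMDl; have := cnt m.+1 mn.
rewrite -[m.+1]addn1 arc_countD arc_count1 cnt ?(ltnW mn) //.
have -> : k * (m + 1) + n - 1 = k * m + n - 1 + k by nia.
by rewrite divn_rotset => /addnI; case: (_ \in U); case: (n - k <= _).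
Qed.


End RotationSets.

(** * Disjointness of rotation sets and the isomorphism with [circ n k] *)

Lemma modn_addB n r d : r < n -> d < n ->
  (r + d) %% n = if r + d < n then r + d else r + d - n.
Proof.
move=> rn dn; case: ltnP => h; first by rewrite modn_small.
by rewrite -{1}(subnK h) modnDr modn_small //; lia.
Qed.

Section RotationSetGraph.
Variables (n k : nat).
Hypotheses (n_gt0 : 0 < n) (k_gt0 : 0 < k).

Lemma affine_mod_onto c r : coprime n k -> c < n -> r < n ->
  exists i : 'I_n, (k * i + c) %% n = r.
Proof.
move=> co_nk cn rn; case: (egcdnP n k_gt0) => km kn e _.
(* [km] inverts [k] modulo [n]; adding [n] keeps the subtraction of [c] from truncating. *)
exists (ordmod n_gt0 (km * (r + n - c))).
rewrite /= -modnDml modnMmr modnDml mulnA [k * km]mulnC e.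
have -> : gcdn k n = 1 by apply/eqP; rewrite gcdnC.
have -> : (kn * n + 1) * (r + n - c) + c = (kn * (r + n - c)) * n + (r + n).
  by nia.
by rewrite modnMDl modnDr modn_small.
Qed.

Hypothesis n_big : 2 * k <= n \/ n = 1.

(** A step to the next index adds [k] to the residue; from the last [k] residues it wraps to one
    below [k], hence outside the set when [2 * k <= n]. *)
Lemma rotset_indep c : @indep (cycle_graph n) (rotset n k c).
Proof.
have succ (i j : 'I_n) :
    i != j -> i \in rotset n k c -> j \in rotset n k c -> i.+1 %% n <> j.
  move=> ne_ij iU jU e.
  have le_2k_n : 2 * k <= n.
    case: n_big => // n1; move: ne_ij; rewrite -val_eqE /=.
    by have := ltn_ord i; have := ltn_ord j; lia.
  move: jU; have -> : j = ordmod n_gt0 (i + 1).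
    by apply: val_inj; rewrite /= addn1 e.
  rewrite mem_rotset_ordmod mulnDr muln1 addnAC -modnDml; move: iU; rewrite inE.
  have := ltn_pmod (k * i + c) n_gt0; move: (_ %% n) => r rn rk.
  by rewrite modn_addB; [case: (ltnP (r + k) n); lia | lia | lia].
apply/indepP => i j iU jU; rewrite /= /cycle_adj.
apply/negP => /andP[ne /orP[] /eqP]; apply: succ => //; by rewrite eq_sym.
Qed.

Hypothesis co_nk : coprime n k.

(** At every index the two residues differ by [d - c], and coprimality makes every residue occur; so
    the question is whether the last [k] residues meet their shift by [d - c]. *)
Lemma rotset_disjoint (c d : 'I_n) : k <= n ->
  [disjoint (rotset n k c : {set 'I_n}) & rotset n k d] =
  (k <= maxn c d - minn c d <= n - k).
Proof.
move=> le_kn; wlog le_cd : c d / c <= d.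
  move=> H; case/orP: (leq_total c d); first exact: H.
  by move=> /H; rewrite disjoint_sym maxnC minnC.
have -> : maxn c d - minn c d = d - c by lia.
have dn := ltn_ord d; have cn := ltn_ord c.
have shift (i : 'I_n) : (k * i + d) %% n = ((k * i + c) %% n + (d - c)) %% n.
  by rewrite modnDml -addnA subnKC.
apply/idP/idP => [dis|far]; last first.
  apply/pred0P => i /=; apply/negP; rewrite !inE shift => /andP[].
  have := ltn_pmod (k * i + c) n_gt0; move: (_ %% n) => r rn.
  by rewrite modn_addB; [case: (ltnP (r + _) n); lia | lia | lia].
have dis_i (i : 'I_n) :
    ~~ ((n - k <= (k * i + c) %% n) && (n - k <= (k * i + d) %% n)).
  by have /pred0P/(_ i) := dis; rewrite /= !inE => ->.
(* The shift carries the residue [n - 1 - (d - c)] to [n - 1]; below, it wraps [n - 1] to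
   [d - c - 1]. In each case both residues would be among the last [k]. *)
have nlt : ~~ (d - c < k).
  apply/negP => lt; have rn : n - 1 - (d - c) < n by lia.
  have [i e] := affine_mod_onto co_nk cn rn; have := dis_i i.
  by rewrite shift e modn_small; lia.
have nlt2 : ~~ (n - k < d - c).
  apply/negP => lt; have rn : n - 1 < n by lia.
  have [i e] := affine_mod_onto co_nk cn rn; have := dis_i i.
  by rewrite shift e modn_addB; [case: (ltnP (n - 1 + _) n); lia | lia | lia].
lia.
Qed.

Lemma rotset_inj (c d : 'I_n) : k <= n ->
  rotset n k c = rotset n k d :> {set 'I_n} -> c = d.
Proof.
move=> le_kn; wlog le_cd : c d / c <= d.
  by move=> H; case/orP: (leq_total c d) => [|l e];
    [exact: H | symmetry; exact: H].
have dn := ltn_ord d; have cn := ltn_ord c.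
move=> e; apply: val_inj; apply/eqP.
rewrite /= eqn_leq le_cd /= leqNgt; apply/negP => lt.
have le_2k_n : 2 * k <= n by case: n_big => // n1; lia.
have mem (i : 'I_n) : (n - k <= (k * i + c) %% n) =
                      (n - k <= ((k * i + c) %% n + (d - c)) %% n).
  by have /setP/(_ i) := e; rewrite !inE modnDml -addnA subnKC.
(* The residue [n - k] stays among the last [k] only if [d - c < k], while [n - 1] wraps to
   [d - c - 1] and stays only if [d - c > n - k]. *)
have [i ei] : exists i : 'I_n, (k * i + c) %% n = n - k.
  by apply: affine_mod_onto => //; lia.
have [j ej] : exists j : 'I_n, (k * j + c) %% n = n - 1.
  by apply: affine_mod_onto => //; lia.
have := mem j; have := mem i; rewrite ei ej.
rewrite modn_addB; [|lia|lia]; rewrite modn_addB; [|lia|lia].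
by case: (ltnP (n - k + _) n); case: (ltnP (n - 1 + _) n); lia.
Qed.

End RotationSetGraph.

Lemma Q_adjE n k (x y : Q n k) : 0 < k ->
  adj x y = [disjoint val (val (val x)) & val (val (val y))].
Proof.
move=> k_gt0; rewrite /= /induced_adj /= /induced_adj /= /kneser_adj.
case: eqP => //= ->; rewrite -setI_eq0 setIid -cards_eq0.
by rewrite (eqP (valP (val (val y)))); case: (k) k_gt0.
Qed.

Lemma Q_build n k (U : {set 'I_n}) : #|U| = k ->
  @indep (cycle_graph n) U -> well_spread U ->
  {V : Q n k | val (val (val V)) = U}.
Proof.
move=> cU iU wU.
have cU' : #|U| == k by apply/eqP.
pose U1 : KG n k := exist _ U cU'.
have iU1 : U1 \in [set A : KG n k | @indep (cycle_graph n) (val A)].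
  by rewrite inE.
pose U2 : SG n k := exist _ U1 iU1.
have iU2 : U2 \in [set A : SG n k | well_spread (val (val A))] by rewrite inE.
by exists (exist _ U2 iU2).
Qed.

(* The case [n = k = 1] is needed because [Q 1 1] is what [Q 2 1] contains. *)
Lemma Q_circ n k : 0 < k <= n -> coprime n k -> 2 * k <= n \/ n = 1 ->
  exists2 f : circ n k -> Q n k, bijective f & {mono f : x y / adj x y}.
Proof.
case/andP=> k_gt0 le_kn co_nk big; have n_gt0 : 0 < n by lia.
pose f (c : circ n k) : Q n k := sval (Q_build (rotset_card n_gt0 le_kn c)
  (rotset_indep n_gt0 k_gt0 big c) (rotset_well_spread n_gt0 le_kn c)).
have fE c : val (val (val (f c))) = rotset n k c.
  by rewrite /f; case: Q_build.
have finj : injective f.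
  move=> c d e; apply: (rotset_inj n_gt0 k_gt0 big co_nk le_kn).
  by rewrite -!fE e.
exists f; last first.
  by move=> c d; rewrite Q_adjE // !fE rotset_disjoint // circ_adjE.
apply: (inj_card_bij finj); rewrite -(card_codom finj).
apply: subset_leq_card; apply/subsetP => V _.
have ws : well_spread (val (val (val V))) by have := valP V; rewrite inE.
have cV : #|val (val (val V))| = k by apply/eqP; exact: valP (val (val V)).
have [c e] := well_spread_rotset n_gt0 le_kn ws cV.
apply/codomP; exists c; do 3!apply: val_inj; by rewrite fE.
Qed.

Lemma SG_star_coloring (R : realFieldType) n k : 0 < k ->
  exists2 w : {set SG n k} -> R,
    fractional_coloring w & total_weight w = (n%:R / k%:R)%R.
Proof.
move=> k_gt0.
pose F (i : 'I_n) : {set SG n k} := [set A : SG n k | i \in val (val A)].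
have [||w cw tw] := @uniform_fractional_coloring R (SG n k) _ F _ k_gt0.
- move=> i; apply/indepP => A B; rewrite !inE => iA iB.
  rewrite /= /induced_adj /= /kneser_adj negb_and; apply/orP; right.
  by apply/pred0P => /(_ i); rewrite /= iA iB.
- move=> A; rewrite -[leqLHS](eqP (valP (val A))) subset_leq_card //.
  by apply/subsetP => i iA; rewrite !inE.
by exists w => //; rewrite tw card_ord.
Qed.

(** * Rotations of [circ n k], used to move the vertex [n - 1] to any given vertex *)

Section CircRotation.
Variables (n k v : nat) (n_gt0 : 0 < n).

Definition circ_rot (x : circ n k) : circ n k := ordmod n_gt0 (x + v).

Lemma circ_rot_inj : injective circ_rot.
Proof.
move=> x y /(congr1 val) /= /eqP; rewrite eqn_modDr !modn_small ?ltn_ord //.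
by move/eqP; exact: val_inj.
Qed.

Lemma circ_rot_mono : 0 < k -> v < n -> {mono circ_rot : x y / adj x y}.
Proof.
move=> k_gt0 vn x y; rewrite !circ_adjE //=.
have xn := ltn_ord x; have yn := ltn_ord y.
rewrite !modn_addB //.
by case: (ltnP (x + v) n); case: (ltnP (y + v) n); lia.
Qed.

End CircRotation.

(** * Rounding maps between [circ a b] and [circ n k] *)

Section FareyNeighbour.
Variables (n k a b : nat).
Hypotheses (a_gt0 : 0 < a) (lt_an : a < n).

Let n_gt0 : 0 < n.
Proof. exact: leq_ltn_trans lt_an. Qed.

Lemma circ_up_subproof (i : 'I_a) : i * n %/ a < n.
Proof. by rewrite ltn_divLR // mulnC ltn_pmul2l ?ltn_ord //; lia. Qed.

Definition circ_up (i : circ a b) : circ n k := Ordinal (circ_up_subproof i).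

(** From [i <= a - 1] one gets [i * n / a <= n - n / a], which is below [n - 1] since [a < n]. *)
Lemma circ_up_neq_last (i : circ a b) : circ_up i != n.-1 :> nat.
Proof.
rewrite /= neq_ltn ltn_divLR //; apply/orP; left.
by have := ltn_ord i; nia.
Qed.

(** Consecutive multiples of [n / a] are more than one apart, so rounding down keeps them
    distinct. *)
Lemma circ_up_inj : injective circ_up.
Proof.
move=> i j /(congr1 val) /= e; apply: val_inj => /=.
have := divn_eq (i * n) a; have := divn_eq (j * n) a.
have := ltn_pmod (i * n) a_gt0; have := ltn_pmod (j * n) a_gt0.
rewrite e; move: (_ %/ _) (i * n %% a) (j * n %% a) => q r s ha hb hc hd.
case: (ltngtP i j) => // lt; nia.
Qed.

Lemma circ_down_subproof (x : 'I_n) : (x.+1 * a - 1) %/ n < a.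
Proof. by rewrite ltn_divLR //; have := ltn_ord x; nia. Qed.

(* For [x < n - 1] the residue of [(x + 1) a] modulo [n] is nonzero and this is
   [(x + 1) a / n]; subtracting [1] only keeps the value at [n - 1] below
   [a]. *)
Definition circ_down (x : circ n k) : circ a b :=
  Ordinal (circ_down_subproof x).

Hypotheses (k_gt0 : 0 < k) (b_gt0 : 0 < b) (lt_kn : k < n)
           (eq_ab : b * n = a * k + 1).

Let le_ba : b <= a.
Proof.
rewrite -(leq_pmul2r n_gt0) eq_ab.
have : a * k.+1 <= a * n by rewrite leq_mul2l lt_kn orbT.
lia.
Qed.

Lemma circ_up_mono : {mono circ_up : x y / adj x y}.
Proof.
move=> i j; wlog le_ij : i j / i <= j.
  move=> H; case/orP: (leq_total i j); first exact: H.
  by move=> /H; rewrite adj_sym => ->; rewrite adj_sym.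
rewrite !circ_adjE //=.
have lt_i := ltn_ord i; have lt_j := ltn_ord j.
have := divn_eq (i * n) a; have := divn_eq (j * n) a.
have := ltn_pmod (i * n) a_gt0; have := ltn_pmod (j * n) a_gt0.
move: (i * n %/ a) (j * n %/ a) (i * n %% a) (j * n %% a) => p q r s.
move: (nat_of_ord i) (nat_of_ord j) le_ij lt_i lt_j.
move=> {}i {}j le_ij lt_i lt_j sa ra ej ei.
have le_pq : p <= q by nia.
have -> : maxn p q - minn p q = q - p by lia.
have -> : maxn i j - minn i j = j - i by lia.
have e : (q - p) * a + s = (j - i) * n + r by nia.
(* The remainders [r] and [s] are below [a], so [d * a] and [t * n] differ by less than [a]; with
   [b * n = a * k + 1] and [a < n] this settles the four comparisons. *)
move: (q - p) (j - i) e => d t e.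
have le_bnan : b * n <= a * n by rewrite leq_mul2r le_ba orbT.
have le_kana : k * a <= n * a by rewrite leq_mul2r (ltnW lt_kn) orbT.
have h1 : b <= t -> k <= d.
  rewrite -(leq_pmul2r n_gt0) -[k <= d]ltnS -(ltn_pmul2r a_gt0); lia.
have h2 : k <= d -> b <= t.
  move=> h; rewrite leqNgt -(leq_pmul2r n_gt0); apply/negP.
  by move: h; rewrite -(leq_pmul2r a_gt0); lia.
have h3 : t <= a - b -> d <= n - k.
  rewrite -(leq_pmul2r n_gt0) -[d <= _]ltnS -(ltn_pmul2r a_gt0).
  by rewrite mulSn !mulnBl; lia.
have h4 : d <= n - k -> t <= a - b.
  move=> h; rewrite leqNgt -(leq_pmul2r n_gt0) mulSn mulnBl; apply/negP.
  by move: h; rewrite -(leq_pmul2r a_gt0) mulnBl; lia.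
by apply/andP/andP => -[/= u1 u2]; split; auto.
Qed.

Lemma circ_down_hom (x y : circ n k) : x != n.-1 :> nat -> y != n.-1 :> nat ->
  adj x y -> adj (circ_down x) (circ_down y).
Proof.
have co_na : coprime n a.
  rewrite /coprime -dvdn1 -(dvdn_addr 1 (dvdn_mulr k (dvdn_gcdr n a))) -eq_ab.
  exact: dvdn_mull (dvdn_gcdl n a).
wlog le_xy : x y / x <= y.
  move=> H hx hy; case/orP: (leq_total x y) => h; first exact: H.
  by rewrite adj_sym => h'; rewrite adj_sym; apply: H.
have lt_x := ltn_ord x; have lt_y := ltn_ord y.
move=> x_last y_last; rewrite !circ_adjE //=.
have ndiv z : z < n -> z != n.-1 -> ~~ (n %| z.+1 * a).
  move=> zn z_last; rewrite Gauss_dvdl //; apply/negP => /dvdn_leq; lia.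
have repr z : z < n -> z != n.-1 ->
    exists2 r, r.+1 < n & z.+1 * a = (z.+1 * a - 1) %/ n * n + r.+1.
  move=> zn z_last; have e := divn_eq (z.+1 * a - 1) n.
  have za : 0 < z.+1 * a by rewrite muln_gt0.
  exists ((z.+1 * a - 1) %% n); last by lia.
  have := ltn_pmod (z.+1 * a - 1) (leq_ltn_trans (leq0n z) zn).
  rewrite leq_eqVlt => /predU1P[er|//].
  have := ndiv _ zn z_last.
  have -> : z.+1 * a = ((z.+1 * a - 1) %/ n).+1 * n by lia.
  by rewrite dvdn_mull.
have [r rn ex] := repr _ lt_x x_last; have [s sn ey] := repr _ lt_y y_last.
move: ((x.+1 * a - 1) %/ n) ((y.+1 * a - 1) %/ n) ex ey => p q ex ey.
move: (nat_of_ord x) (nat_of_ord y) le_xy lt_x lt_y ex ey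
  => {x_last y_last}x {}y le_xy lt_x lt_y ex ey.
have le_xya : x.+1 * a <= y.+1 * a by rewrite leq_mul2r ltnS le_xy orbT.
have le_pq : p <= q by rewrite -ltnS -(ltn_pmul2r n_gt0) mulSn; lia.
have le_pqn : p * n <= q * n by rewrite leq_mul2r le_pq orbT.
have -> : maxn p q - minn p q = q - p by lia.
have -> : maxn x y - minn x y = y - x by lia.
have e : (q - p) * n + s = (y - x) * a + r by rewrite !mulnBl; lia.
(* The remainders [r.+1] and [s.+1] lie between [1] and [n - 1], so [d * n] and [t * a] differ by at
   most [n - 2]. One more would be too much, since [b * n = a * k + 1]. *)
move: (q - p) (y - x) e => d t e /andP[ht1 ht2].
have le_bnan : b * n <= a * n by rewrite leq_mul2r le_ba orbT.
have le_kana : k * a <= n * a by rewrite leq_mul2r (ltnW lt_kn) orbT.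
move: ht1; rewrite -(leq_pmul2r a_gt0) => u1.
move: ht2; rewrite -(leq_pmul2r a_gt0) mulnBl => u2; apply/andP; split.
  by rewrite leqNgt -(leq_pmul2r n_gt0) mulSn; apply/negP; lia.
by rewrite leqNgt -(leq_pmul2r n_gt0) mulSn mulnBl; apply/negP; lia.
Qed.

End FareyNeighbour.

(** * Fractional chromatic numbers from pairs of homomorphisms *)

Local Open Scope ring_scope.

Lemma graph_hom_comp (F G H : sgraph) (f : G -> H) (g : F -> G) :
  graph_hom f -> graph_hom g -> graph_hom (f \o g).
Proof. by move=> hf hg x y /hg /hf. Qed.

Lemma graph_hom_val (G : sgraph) (S : {set G}) :
  graph_hom (val : induced S -> G).
Proof. by []. Qed.

Lemma graph_hom_corestrict (G H : sgraph) (S : {set H}) (f : G -> H) :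
  (forall x, f x \in S) -> graph_hom f ->
  exists f' : G -> induced S, graph_hom f'.
Proof.
by move=> fS hf; exists (fun x => exist (fun y => y \in S) (f x) (fS x)).
Qed.

(** Pulling the star colouring back along [g] gives the upper bound; pulling any colouring of [G]
    back along [f] to [circ n k] gives the lower bound. *)
Lemma chi_f_is_sandwich (R : realFieldType) n k (G : sgraph)
    (f : circ n k -> G) (g : G -> SG n k) :
  (0 < k)%N -> (2 * k <= n)%N \/ n = 1%N -> graph_hom f -> graph_hom g ->
  chi_f_is G (n%:R / k%:R : R).
Proof.
move=> k_gt0 big hf hg; split.
  have [w cw <-] := SG_star_coloring R n k_gt0.
  exact: fractional_coloring_pullback hg cw.
move=> w /(fractional_coloring_pullback hf)[w' cw' <-].
exact: circ_total_weight.
Qed.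

Theorem theorem9 (R : realFieldType) (n k a b : nat)
  (n_gt0 : (0 < n)%N) (k_gt0 : (0 < k)%N)
  (le_2k_n : (2 * k <= n)%N) (co_nk : gcdn n k = 1%N)
  (a_gt0 : (0 < a)%N) (b_gt0 : (0 < b)%N) (eq_ab : (a * k = b * n - 1)%N)
  (min_ab : forall a' b' : nat, (0 < a')%N -> (0 < b')%N ->
    (a' * k = b' * n - 1)%N -> (a <= a')%N /\ (b <= b')%N) :
  (chi_f_is (Q n k) (n%:R / k%:R : R) /\ chi_f_is (SG n k) (n%:R / k%:R : R)) /\
  ((forall U : Q n k, chi_f_is (delete_vertex U) (a%:R / b%:R : R)) /\
   (a%:R / b%:R < n%:R / k%:R :> R) /\
   chi_f_vertex_critical R (Q n k)) /\
  has_induced_copy (Q n k) (Q a b).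
Proof.
have eq_ba : (b * n = a * k + 1)%N by nia.
have n_gt1 : (1 < n)%N by lia.
have lt_kn : (k < n)%N by lia.
(* If [a > n], then [a - n] and [b - k] form a smaller positive solution; [a = n] would make [n]
   divide [1]. *)
have lt_an : (a < n)%N.
  rewrite ltnNge; apply/negP => le_na.
  have lt_kb : (k < b)%N.
    by rewrite -(ltn_pmul2r n_gt0); have := leq_mul le_na (leqnn k); lia.
  have lt_na : (n < a)%N.
    rewrite ltn_neqAle le_na andbT; apply/eqP => e; subst a.
    have : (n %| n * k + 1)%N by rewrite -eq_ba dvdn_mull.
    by rewrite dvdn_addr ?dvdn_mulr // dvdn1; lia.
  have := min_ab (a - n)%N (b - k)%N.
  rewrite !subn_gt0 !mulnBl => /(_ lt_na lt_kb).
  by case; nia.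
have co_ab : coprime a b.
  rewrite /coprime -dvdn1 -(dvdn_addr 1 (dvdn_mulr k (dvdn_gcdl a b))) -eq_ba.
  exact: dvdn_mulr (dvdn_gcdr a b).
have big_nk : (2 * k <= n)%N \/ n = 1%N by left.
(* For [n > 2 * k], having [a < 2 * b] would give [b + k <= 1]. For [n = 2 * k], coprimality forces
   [k = 1] and then [a = 1]. *)
have big_ab : (2 * b <= a)%N \/ a = 1%N.
  case: (ltngtP n (2 * k)) => [||e2]; first by lia.
    move=> lt; left; rewrite leqNgt; apply/negP => ltab.
    have : (b * (2 * k).+1 <= b * n)%N by rewrite leq_mul2l lt orbT.
    have : (a.+1 * k <= 2 * b * k)%N by rewrite leq_mul2r ltab orbT.
    lia.
  have : (k %| 1)%N by rewrite -co_nk dvdn_gcd e2 dvdn_mull dvdnn.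
  by rewrite dvdn1; right; nia.
have le_ba : (0 < b <= a)%N.
  rewrite b_gt0 -(leq_pmul2r n_gt0) eq_ba.
  have : (a * k.+1 <= a * n)%N by rewrite leq_mul2l lt_kn orbT.
  lia.
have k01 : (0 < k <= n)%N by rewrite k_gt0 ltnW.
have [f bij_f mono_f] := Q_circ k01 (introT eqP co_nk) big_nk.
have [g bij_g mono_g] := Q_circ le_ba co_ab big_ab.
have [f' fK f'K] := bij_f; have [g' gK g'K] := bij_g.
have mono_f' : {mono f' : x y / adj x y} by move=> x y; rewrite -mono_f !f'K.
have mono_g' : {mono g' : x y / adj x y} by move=> x y; rewrite -mono_g !g'K.
have hom_f : graph_hom f by move=> x y; rewrite mono_f.
have hom_g : graph_hom g by move=> x y; rewrite mono_g.
have chiQ : chi_f_is (Q n k) (n%:R / k%:R : R).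
  exact: chi_f_is_sandwich k_gt0 big_nk hom_f (@graph_hom_val _ _).
have up_inj : injective (circ_up k a_gt0 lt_an) :=
  @circ_up_inj n k a b a_gt0 lt_an.
have up_mono := circ_up_mono a_gt0 lt_an k_gt0 b_gt0 lt_kn eq_ba.
have chiD (U : Q n k) : chi_f_is (delete_vertex U) (a%:R / b%:R : R).
  (* Rotating by [f' U + 1] takes the vertex [n - 1] to [f' U]. *)
  have lt_vn : ((f' U).+1 %% n < n)%N by rewrite ltn_pmod.
  pose rot := @circ_rot n k ((f' U).+1 %% n) n_gt0.
  have inj_rot : injective rot by exact: circ_rot_inj.
  have mono_rot : {mono rot : x y / adj x y} by exact: circ_rot_mono.
  have [rot' rotK rot'K] := injF_bij inj_rot.
  have mono_rot' : {mono rot' : x y / adj x y}.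
    by move=> x y; rewrite -mono_rot !rot'K.
  have rot_last (x : circ n k) : x = n.-1 :> nat -> rot x = f' U.
    move=> e; apply: val_inj; rewrite /= e modnDmr addnS -addSn prednK //.
    by rewrite modnDl modn_small.
  have low_neq (i : circ a b) : f (rot (circ_up k a_gt0 lt_an i)) \in [set~ U].
    rewrite !inE; apply/eqP => e; have lt_n : (n.-1 < n)%N by rewrite prednK.
    have := @circ_up_neq_last n k a b a_gt0 lt_an i.
    suff -> : circ_up k a_gt0 lt_an i = Ordinal lt_n by rewrite eqxx.
    by apply: inj_rot; rewrite [RHS]rot_last // -e fK.
  have hom_low : graph_hom
      (fun i : circ a b => f (rot (circ_up k a_gt0 lt_an i))).
    by move=> x y xy; rewrite mono_f mono_rot up_mono.
  have [low {}hom_low] := graph_hom_corestrict low_neq hom_low.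
  (* Undoing the rotation places [U] at [n - 1], so [circ_down] is a homomorphism on the remaining
     vertices; it continues through [Q a b] into [SG a b]. *)
  pose high (x : delete_vertex U) : circ n k := rot' (f' (val x)).
  have high_neq x : (high x != n.-1 :> nat).
    apply/eqP => /rot_last; rewrite rot'K => /(can_inj f'K) e.
    by have := valP x; rewrite !inE e eqxx.
  have hom_down : graph_hom (fun x : delete_vertex U =>
      circ_down b a_gt0 lt_an (high x)).
    move=> x y /graph_hom_val xy.
    apply: (circ_down_hom a_gt0 lt_an k_gt0 b_gt0 lt_kn eq_ba
              (high_neq x) (high_neq y)).
    by rewrite mono_rot' mono_f' xy.
  have hom_col :=
    graph_hom_comp (@graph_hom_val _ _) (graph_hom_comp hom_g hom_down).
  exact: chi_f_is_sandwich b_gt0 big_ab hom_low hom_col.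
have lt_ratio : a%:R / b%:R < n%:R / k%:R :> R.
  rewrite ltr_pdivrMr ?ltr0n // mulrAC ltr_pdivlMr ?ltr0n //.
  by rewrite -!natrM ltr_nat; lia.
split.
  split=> //; have hom_SG := graph_hom_comp (@graph_hom_val _ _) hom_f.
  exact: chi_f_is_sandwich k_gt0 big_nk hom_SG (fun x y xy => xy).
split; last first.
  apply: (has_induced_copy_mono
            (f := fun x => f (circ_up k a_gt0 lt_an (g' x)))).
    by move=> x y /(can_inj fK) /up_inj /(can_inj g'K).
  by move=> x y; rewrite mono_f up_mono mono_g'.
split=> //; split=> //; exists (n%:R / k%:R) => // U.
by exists (a%:R / b%:R).
Qed.
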